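(* Let $R$ be a standard graded polynomial ring over a field $k$, $I\subseteq R$ a homogeneous ideal of initial degree $\ell$, and $(F_\bullet,d_\bullet)$ a minimal homogeneous free resolution of $R/I$. Write $F_1=F_1'\oplus\bigoplus_{j=1}^t Re_0^j$, where each $e_0^j$ generates a free direct summand of $F_1$, and correspondingly $d_2=d_2'+d_0^1+\cdots+d_0^t$ with $d_2'\in\operatorname{Hom}_R(F_2,F_1')$ and $d_0^j\in\operatorname{Hom}_R(F_2,Re_0^j)$. For each $j=1,\dots,t$ let $\mathfrak a_j$ be any homogeneous ideal with $d_0^j(F_2)\subseteq\mathfrak a_je_0^j$, and let $(G^j_\bullet,m^j_\bullet)$ be a minimal homogeneous free resolution of $R/\mathfrak a_j$. Put $K'=\operatorname{im}(d_1|_{F_1'}:F_1'\to R)$, $K_0^j=\operatorname{im}(d_1|_{Re_0^j}:Re_0^j\to R)$ and $J=K'+\mathfrak a_1K_0^1+\cdots+\mathfrak a_tK_0^t$. Let $Q_{i-1}:F_i\to\bigoplus_{j=1}^tG^j_{i-1}$ $(i\ge 2)$ be the maps of the associated iterated trimming complex. For $i>1$ let $$C_i:=\ker\Big((Q_{i-1})_{i+\ell-1}:(F_i)_{i+\ell-1}\to\bigoplus_{j=1}^t(G^j_{i-1})_{i+\ell-1}\Big).$$ Then the complex $$\cdots\xrightarrow{d_{i+1}}C_i\xrightarrow{d_i}\cdots\xrightarrow{d_3}C_2\xrightarrow{d_2'}F_1'\to0$$ is the linear strand of $J$.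
   Context: Linear strand: if $F_\bullet$ is a minimal graded complex of free $R$-modules with $F_0$ of initial degree $d$, its linear strand is the complex obtained by restricting the differential $d_i^F$ to $(F_i)_{d+i}$ for each $i\ge1$; after choosing bases, this means restricting to the columns of the matrices of the differentials in which only linear entries occur. Here, for a graded free module $F$, $(F)_e$ is understood as the part of $F$ generated in degree $e$. For a resolution of $R/I$ with $I$ of initial degree $\ell$, the linear strand of $I$ is the part of $F_i$ generated in degree $\ell+i-1$, $i\ge1$. Iterated trimming complex: with the data in the claim there is a morphism of complexes from $$\cdots\to F_i\xrightarrow{d_i}\cdots\xrightarrow{d_3}F_2\xrightarrow{d_2'}F_1'$$ to $$\cdots\to\bigoplus_jG^j_{i-1}\xrightarrow{\oplus m^j_{i-1}}\cdots\xrightarrow{\oplus m^j_2}\bigoplus_jG^j_1\xrightarrow{-\sum_j m_1^j(-)\cdot d_1(e_0^j)}R,$$ given by $d_1:F_1'\to R$ and maps $Q_{i-1}:F_i\to\bigoplus_jG^j_{i-1}$ for $i\ge2$, whose mapping cone is a free resolution of $R/J$. This mapping cone is called the iterated trimming complex. The degrees of $G^j_\bullet$ are taken with the shift by $\deg e_0^j$ that makes these maps homogeneous of degree $0$.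
   Formalization: In the displayed complex F_1' is replaced by its part generated in degree ℓ, the linear strand of J is taken in degree ℓ (not J's initial degree), and I and all a_j are proper; as printed the claim fails if F_1' has generators of degree >ℓ, if F_1'=0, or if a_j=R. *)

(* Defs.v *)
From mathcomp Require Import all_boot all_order all_algebra.
From mathcomp Require Import mpoly.

Set Implicit Arguments.
Unset Strict Implicit.
Unset Printing Implicit Defensive.

Import GRing.Theory.
Local Open Scope ring_scope.

(* R = {mpoly k[n]} with its standard grading.  A finitely generated graded
   free module is given by a homogeneous basis: [GrFree r deg] stands for
   \bigoplus_s R(-deg s), realised on column vectors 'cV[R]_r.  A map from F
   to E is a matrix with rk E rows and rk F columns, acting on the left.
   All modules below are generated in nonnegative degrees. *)
Record grfree := GrFree { rk : nat; gdeg : 'I_rk -> nat }.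

Definition grR : grfree := @GrFree 1 (fun _ => 0%N).

Definition gshift (a : nat) (F : grfree) : grfree :=
  GrFree (fun s : 'I_(rk F) => (gdeg s + a)%N).

Definition gsum (E F : grfree) : grfree :=
  @GrFree (rk E + rk F)
    (fun s => match split s with inl u => gdeg u | inr v => gdeg v end).

Definition gbigsum (t : nat) (M : 'I_t -> grfree) : grfree :=
  @GrFree (\sum_(j < t) rk (M j))
    (fun s => gdeg (tagnat.sig2 s : 'I_(rk (M (tagnat.sig1 s))))).

(* (F)_e in the sense of the part generated in degree e: the free summand on
   the basis elements of degree e.  It does not depend on the basis when F has
   no generator in degree < e, as in all strands of minimal resolutions. *)
Definition gpart (e : nat) (F : grfree) : grfree :=
  @GrFree #|[pred s : 'I_(rk F) | gdeg s == e]| (fun _ => e).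

Definition with_R (M : nat -> grfree) (i : nat) : grfree :=
  if i is i'.+1 then M i' else grR.

Section Complexes.
Context {k : fieldType} {n : nat}.
Local Notation R := {mpoly k[n]}.

(* A is homogeneous of degree 0: every nonzero entry A r c is a form of degree
   gdeg c - gdeg r (and A r c = 0 when this difference is negative). *)
Definition homog_map (E F : grfree) (A : 'M[R]_(rk E, rk F)) : Prop :=
  forall r c m, m \in msupp (A r c) -> (mdeg m + gdeg r = gdeg c)%N.

(* The map (F)_b -> (E)_a induced by A : F -> E. *)
Definition restr (E F : grfree) (a b : nat) (A : 'M[R]_(rk E, rk F)) :
    'M[R]_(rk (gpart a E), rk (gpart b F)) :=
  mxsub (fun r => enum_val r) (fun c => enum_val c) A.

Record gcomplex := GComplex {
  gmod :> nat -> grfree;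
  gdiff : forall i, 'M[R]_(rk (gmod i), rk (gmod i.+1))
}.

(* Sequences with R, generated in degree 0, in homological degree 0. *)
Record rcomplex := RComplex {
  rtail : nat -> grfree;
  rdiff : forall i, 'M[R]_(rk (with_R rtail i), rk (with_R rtail i.+1))
}.
Coercion gcomplex_of_rcomplex (F : rcomplex) : gcomplex :=
  @GComplex (with_R (rtail F)) (@rdiff F).

Definition is_gcomplex (C : gcomplex) : Prop :=
  (forall i, homog_map (gdiff C i)) /\
  (forall i, gdiff C i *m gdiff C i.+1 = 0).

Definition minimal (C : gcomplex) : Prop :=
  forall i r c, (gdiff C i r c)@_0%MM = 0.

Definition is_ideal (I : R -> Prop) : Prop :=
  [/\ I 0, (forall f g, I f -> I g -> I (f + g))
    & (forall f g, I g -> I (f * g))].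

Definition homog_ideal (I : R -> Prop) : Prop :=
  is_ideal I /\ (forall f d, I f -> I (pihomog mdeg d f)).

Definition initial_degree (I : R -> Prop) (l : nat) : Prop :=
  (exists f, [/\ I f, f != 0 & f \is l.-homog]) /\
  (forall f d, I f -> f != 0 -> f \is d.-homog -> (l <= d)%N).

Definition idealM (A B : R -> Prop) (f : R) : Prop :=
  exists (m : nat) (a b : 'I_m -> R),
    (forall i, A (a i) /\ B (b i)) /\ f = \sum_i a i * b i.

Definition idealD (A B : R -> Prop) (f : R) : Prop :=
  exists a b, [/\ A a, B b & f = a + b].

Definition idealsum (t : nat) (A : 'I_t -> R -> Prop) (f : R) : Prop :=
  exists a : 'I_t -> R, (forall j, A j (a j)) /\ f = \sum_j a j.

Definition im_in_R (r : nat) (A : 'M[R]_(1, r)) (f : R) : Prop :=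
  exists v : 'cV[R]_r, f = (A *m v) 0 0.

Definition resolution (I : R -> Prop) (F : rcomplex) : Prop :=
  [/\ is_gcomplex F,
      (forall i (v : 'cV[R]_(rk (F i.+1))),
         gdiff F i *m v = 0 -> exists w, v = gdiff F i.+1 *m w)
    & (forall f, I f <-> im_in_R (gdiff F 0) f)].

Definition min_resolution (I : R -> Prop) (F : rcomplex) : Prop :=
  resolution I F /\ minimal F.

Definition strand (d : nat) (F : gcomplex) : gcomplex :=
  @GComplex (fun i => gpart (d + i)%N (F i))
            (fun i => restr (d + i)%N (d + i.+1)%N (gdiff F i)).

Definition truncate (F : gcomplex) : gcomplex :=
  @GComplex (fun i => F i.+1) (fun i => gdiff F i.+1).

(* Linear strand in degree l of an ideal, F being a minimal resolution of the
   quotient: the parts of F_i generated in degree l + i - 1 for i >= 1, so that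
   index i here is homological degree i + 1 of F. *)
Definition linear_strand (l : nat) (F : rcomplex) : gcomplex :=
  strand l (truncate F).

(* The mapping cone of f : S -> T for T with T_0 = R; its term in degree i + 1
   is S_i (+) T_(i+1), and its differential is (s, u) |-> (- d s, f s + d u). *)
Definition cone_tail (S : gcomplex) (T : rcomplex) (i : nat) : grfree :=
  gsum (S i) (T i.+1).

Definition cone_diff (S : gcomplex) (T : rcomplex)
    (f : forall i, 'M[R]_(rk (T i), rk (S i))) (i : nat) :
    'M[R]_(rk (with_R (cone_tail S T) i), rk (with_R (cone_tail S T) i.+1)) :=
  match i return 'M[R]_(rk (with_R (cone_tail S T) i),
                        rk (with_R (cone_tail S T) i.+1)) with
  | 0 => row_mx (f 0) (gdiff T 0)
  | i'.+1 => block_mx (- gdiff S i') 0 (f i'.+1) (gdiff T i'.+1)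
  end.

Definition cone (S : gcomplex) (T : rcomplex)
    (f : forall i, 'M[R]_(rk (T i), rk (S i))) : rcomplex :=
  RComplex (cone_diff f).

Definition chain_map (S T : gcomplex)
    (f : forall i, 'M[R]_(rk (T i), rk (S i))) : Prop :=
  (forall i, homog_map (f i)) /\
  (forall i, gdiff T i *m f i.+1 = f i *m gdiff S i).

(* The free complex L is isomorphic, as a complex of graded modules, to the
   complex of submodules C_i of A_i with the differential of A: phi_i is an
   injection of L_i into A_i with image C_i. *)
Definition iso_subcomplex (L A : gcomplex)
    (C : forall i, 'cV[R]_(rk (A i)) -> Prop) : Prop :=
  exists phi : forall i, 'M[R]_(rk (A i), rk (L i)),
    [/\ chain_map phi,
        (forall i (u : 'cV[R]_(rk (L i))), phi i *m u = 0 -> u = 0)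
      & (forall i v, C i v <-> exists u, v = phi i *m u)].

Section Trimming.
Context {F : rcomplex} {F1' : grfree} {t : nat}.

(* F_1 = F_1' (+) (+)_j R e_0^j: the columns of [iota] are a homogeneous basis
   of F_1' and e j = e_0^j is homogeneous of degree [dege j]. *)
Definition splitting (iota : 'M[R]_(rk (F 1%N), rk F1'))
    (e : 'I_t -> 'cV[R]_(rk (F 1%N))) (dege : 'I_t -> nat) : Prop :=
  [/\ homog_map iota,
      (forall j, @homog_map (F 1%N) (gshift (dege j) grR) (e j))
    & bijective (fun uc : 'cV[R]_(rk F1') * 'cV[R]_t =>
                   iota *m uc.1 + \sum_j uc.2 j 0 *: e j)].

(* Top row: ... -> F_3 -> F_2 -d2'-> F_1', with F_1' in degree 0. *)
Definition top_mod (i : nat) : grfree :=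
  if i is i'.+1 then F i'.+2 else F1'.

Definition top_diff (d2' : 'M[R]_(rk F1', rk (F 2%N))) (i : nat) :
    'M[R]_(rk (top_mod i), rk (top_mod i.+1)) :=
  match i return 'M[R]_(rk (top_mod i), rk (top_mod i.+1)) with
  | 0 => d2'
  | i'.+1 => gdiff F i'.+2
  end.

Definition top_row (d2' : 'M[R]_(rk F1', rk (F 2%N))) : gcomplex :=
  GComplex (top_diff d2').

(* Bottom row: ... -> (+)_j G^j_2 -> (+)_j G^j_1 -> R, with G^j shifted by
   deg e_0^j and last map - \sum_j m_1^j(-) d_1(e_0^j). *)
Definition bot_tail (G : 'I_t -> rcomplex) (dege : 'I_t -> nat) (i : nat) :
    grfree :=
  gbigsum (fun j => gshift (dege j) (G j i.+1)).

(* The second branch is the block diagonal matrix (+)_j m^j_i; conform_mx only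
   transports the block of G j to the (equal, as j = j') block sizes. *)
Definition bot_diff (G : 'I_t -> rcomplex) (dege : 'I_t -> nat)
    (e : 'I_t -> 'cV[R]_(rk (F 1%N))) (i : nat) :
    'M[R]_(rk (with_R (bot_tail G dege) i),
           rk (with_R (bot_tail G dege) i.+1)) :=
  match i return 'M[R]_(rk (with_R (bot_tail G dege) i),
                        rk (with_R (bot_tail G dege) i.+1)) with
  | 0 => \mxrow_(j < t) (- (gdiff F 0 *m e j) 0 0 *: gdiff (G j) 0)
  | i'.+1 => \mxblock_(j < t, j' < t)
       (if j == j' then
          conform_mx (0 : 'M[R]_(rk (G j i'.+1), rk (G j' i'.+2)))
                     (gdiff (G j) i'.+1)
        else 0)
  end.

Definition bot_row (G : 'I_t -> rcomplex) (dege : 'I_t -> nat)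
    (e : 'I_t -> 'cV[R]_(rk (F 1%N))) : rcomplex :=
  RComplex (bot_diff G dege e).

(* The vertical maps d_1 : F_1' -> R and Q i = Q_(i+1) : F_(i+2) ->
   (+)_j G^j_(i+1). *)
Definition vert (iota : 'M[R]_(rk (F 1%N), rk F1'))
    (G : 'I_t -> rcomplex) (dege : 'I_t -> nat)
    (Q : forall i, 'M[R]_(rk (bot_tail G dege i), rk (F i.+2))) (i : nat) :
    'M[R]_(rk (with_R (bot_tail G dege) i), rk (top_mod i)) :=
  match i return 'M[R]_(rk (with_R (bot_tail G dege) i), rk (top_mod i)) with
  | 0 => gdiff F 0 *m iota
  | i'.+1 => Q i'
  end.

(* The maps Q define an iterated trimming complex: a morphism from the top row
   to the bottom row whose mapping cone is a free resolution of R/J. *)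
Definition iterated_trimming (J : R -> Prop)
    (iota : 'M[R]_(rk (F 1%N), rk F1')) (d2' : 'M[R]_(rk F1', rk (F 2%N)))
    (e : 'I_t -> 'cV[R]_(rk (F 1%N))) (dege : 'I_t -> nat)
    (G : 'I_t -> rcomplex)
    (Q : forall i, 'M[R]_(rk (bot_tail G dege i), rk (F i.+2))) : Prop :=
  @chain_map (top_row d2') (bot_row G dege e) (vert iota Q) /\
  resolution J (@cone (top_row d2') (bot_row G dege e) (vert iota Q)).

(* J = K' + a_1 K_0^1 + ... + a_t K_0^t. *)
Definition trimmed_ideal (iota : 'M[R]_(rk (F 1%N), rk F1'))
    (e : 'I_t -> 'cV[R]_(rk (F 1%N))) (a : 'I_t -> R -> Prop) : R -> Prop :=
  idealD (im_in_R (gdiff F 0 *m iota))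
         (idealsum (fun j => idealM (a j) (im_in_R (gdiff F 0 *m e j)))).

(* The submodules of the degree l + i - 1 parts (F_1')_l, (F_2)_(l+1), ...:
   everything in homological degree 1, and in homological degree i + 2 the
   kernel C_(i+2) of the map (F_(i+2))_(l+i+1) -> (+)_j (G^j_(i+1))_(l+i+1)
   induced by Q_(i+1).  Only the part (F_1')_l of F_1' can meet a linear
   strand; it is all of F_1' when F_1' is generated in degree l. *)
Definition trimmed_strand (l : nat) (d2' : 'M[R]_(rk F1', rk (F 2%N)))
    (G : 'I_t -> rcomplex) (dege : 'I_t -> nat)
    (Q : forall i, 'M[R]_(rk (bot_tail G dege i), rk (F i.+2))) (i : nat) :
    'cV[R]_(rk (strand l (top_row d2') i)) -> Prop :=
  match i return 'cV[R]_(rk (strand l (top_row d2') i)) -> Prop with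
  | 0 => fun _ => True
  | i'.+1 => fun v =>
      restr (l + i'.+1)%N (l + i'.+1)%N (Q i') *m v = 0
  end.

End Trimming.
End Complexes.

Arguments gcomplex : clear implicits.
Arguments rcomplex : clear implicits.

(* Main.v *)
(* The iterated trimming complex T and the minimal resolution H both resolve
   R/J, so there are comparison maps al : H -> T and be : T -> H that are
   inverse up to homotopy.  F_i and H_i are generated in degrees >= l + i - 1,
   while the shifted (+)_j G^j_i is generated in degrees >= l + i, because e_0^j
   has degree >= l and no a_j is the unit ideal.  Hence in degree l + i - 1 only
   the summand F_i of T_i (F_1' if i = 1) survives, al and be become scalar
   matrices, and minimality kills every homotopy term except the one that
   factors through Q_{i-1}.  So be \o al = 1 on the linear strand of H, and
   al \o be = 1 on ker Q_{i-1}, which is thus the image of al.  The isomorphism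
   carries the sign (-1)^i because the cone has differential -d on F. *)
Require Import Defs.
From mathcomp Require Import all_boot all_order all_algebra.
From mathcomp Require Import mpoly.
From Stdlib Require Import ClassicalEpsilon.
Set Implicit Arguments.
Unset Strict Implicit.
Unset Printing Implicit Defensive.
Import GRing.Theory.
Local Open Scope ring_scope.

(** * Homogeneous components of a product *)

Lemma pihomogM (k : fieldType) (n d e : nat) (p q : {mpoly k[n]}) :
  p \is e.-homog ->
  pihomog mdeg d (p * q) =
    if (e <= d)%N then p * pihomog mdeg (d - e) q else 0.
Proof.
move=> hp.
(* The summation bound is padded by [d.+1] so that [d - e], the index of the only component of [q]
   that contributes, is in range. *)
have /(pihomog_partitionE (mf := mdeg)) qE :
  (mmeasure mdeg q <= mmeasure mdeg q + d.+1)%N by exact: leq_addr.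
rewrite [in LHS]qE mulr_sumr linear_sum /=.
have hom i : p * pihomog mdeg i q \is (e + i)%N.-homog.
  by apply: dhomogM hp _; exact: pihomogP.
case: leqP => hed.
  have lt : (d - e < mmeasure mdeg q + d.+1)%N.
    by rewrite ltn_addl // ltnS leq_subr.
  rewrite (bigD1 (Ordinal lt)) //= big1 => [|i hi].
    have := hom (d - e)%N; rewrite subnKC // => /pihomog_dE ->.
    exact: addr0.
  rewrite (@pihomog_ne0 _ _ _ (e + i)%N) //.
  apply: contra hi => /eqP ei; apply/eqP/val_inj => /=.
  by apply/esym/eqP; rewrite -(eqn_add2l e) ei subnKC.
apply: big1 => i _; rewrite (@pihomog_ne0 _ _ _ (e + i)%N) //.
by rewrite neq_ltn (leq_trans hed (leq_addr _ _)) orbT.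
Qed.

(** * Degree-0 maps of graded free modules and their restriction to generators of one degree *)

Section HomogeneousMaps.
Context {k : fieldType} {n : nat}.
Local Notation R := {mpoly k[n]}.
Implicit Types E F P : grfree.

Lemma homog_dhomog E F (A : 'M[R]_(rk E, rk F)) r c :
  homog_map A -> A r c \is (gdeg c - gdeg r).-homog.
Proof. by move=> hA; apply/dhomogP => m /hA <-; rewrite addnK. Qed.

Lemma homog_eq0 E F (A : 'M[R]_(rk E, rk F)) r c :
  homog_map A -> (gdeg c < gdeg r)%N -> A r c = 0.
Proof.
move=> hA lt; apply/mpolyP => m; rewrite mcoeff0; apply/eqP.
apply: contraTT lt; rewrite -mcoeff_msupp => /hA <-.
by rewrite -leqNgt leq_addl.
Qed.

(** With [gdeg c <= gdeg r] a nonzero entry would have to be a constant, which the vanishing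
    constant term excludes. *)
Lemma homog_min_eq0 E F (A : 'M[R]_(rk E, rk F)) r c :
  homog_map A -> (A r c)@_0%MM = 0 -> (gdeg c <= gdeg r)%N -> A r c = 0.
Proof.
move=> hA A0 le; apply/mpolyP => m; rewrite mcoeff0; apply/eqP.
apply: contraTT le => nz; rewrite -ltnNge.
have := nz; rewrite -mcoeff_msupp => /hA <-; rewrite -[ltnLHS]add0n ltn_add2r.
by rewrite lt0n mdeg_eq0; apply: contra nz => /eqP ->; rewrite A0.
Qed.

Lemma homog_map0 E F : homog_map (0 : 'M[R]_(rk E, rk F)).
Proof. by move=> r c m; rewrite mxE msupp0. Qed.

Lemma homog_map1 E : homog_map (1%:M : 'M[R]_(rk E, rk E)).
Proof.
move=> r c m; rewrite mxE; case: eqVneq => [->|_].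
  by rewrite msupp1 inE => /eqP ->; rewrite mdeg0.
by rewrite msupp0.
Qed.

Lemma homog_mapD E F (A B : 'M[R]_(rk E, rk F)) :
  homog_map A -> homog_map B -> homog_map (A + B).
Proof.
move=> hA hB r c m; rewrite mxE => /msuppD_le.
by rewrite mem_cat => /orP[/hA|/hB].
Qed.

Lemma homog_mapN E F (A : 'M[R]_(rk E, rk F)) :
  homog_map A -> homog_map (- A).
Proof. by move=> hA r c m; rewrite mxE (perm_mem (msuppN _)) => /hA. Qed.

Lemma homog_mapB E F (A B : 'M[R]_(rk E, rk F)) :
  homog_map A -> homog_map B -> homog_map (A - B).
Proof. by move=> hA hB; apply: homog_mapD => //; exact: homog_mapN. Qed.

Lemma homog_mapM E F P (A : 'M[R]_(rk E, rk F)) (B : 'M[R]_(rk F, rk P)) :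
  homog_map A -> homog_map B -> homog_map (A *m B).
Proof.
move=> hA hB r c m; rewrite mxE => /msupp_sum_le.
case/flattenP=> _ /mapP[s _ ->] /msuppM_le /allpairsP[[m1 m2] /= [h1 h2 ->]].
by rewrite mdegD -(hB _ _ _ h2) -(hA _ _ _ h1) addnCA addnA.
Qed.

(** The degree-0 component of an arbitrary matrix. The test guards against truncated subtraction,
    which would keep constants where the required degree is negative. *)
Definition homog_part E F (W : 'M[R]_(rk E, rk F)) : 'M[R]_(rk E, rk F) :=
  \matrix_(r, c) if (gdeg r <= gdeg c)%N
                 then pihomog mdeg (gdeg c - gdeg r) (W r c) else 0.

Lemma homog_part_homog E F (W : 'M[R]_(rk E, rk F)) : homog_map (homog_part W).
Proof.
move=> r c m; rewrite mxE; case: leqP => [le|_]; last by rewrite msupp0.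
by move/(dhomogP _ _ _ (pihomogP _ _ _)) => /= ->; rewrite subnK.
Qed.

Lemma homog_part_id E F (W : 'M[R]_(rk E, rk F)) :
  homog_map W -> homog_part W = W.
Proof.
move=> hW; apply/matrixP => r c; rewrite mxE; case: leqP => [le|lt].
  by rewrite pihomog_dE // homog_dhomog.
by rewrite homog_eq0.
Qed.

(** A degree-0 map respects the decomposition into homogeneous components. *)
Lemma homog_partM E F P (A : 'M[R]_(rk E, rk F)) (W : 'M[R]_(rk F, rk P)) :
  homog_map A -> homog_part (A *m W) = A *m homog_part W.
Proof.
move=> hA; apply/matrixP => r c; rewrite !mxE.
case: leqP => [le|lt]; last first.
  rewrite big1 // => s _; rewrite mxE.
  case: leqP => [le|]; last by rewrite mulr0.
  by rewrite (homog_eq0 hA (leq_ltn_trans le lt)) mul0r.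
rewrite linear_sum; apply: eq_bigr => s _; rewrite /= mxE.
case: (ltnP (gdeg s) (gdeg r)) => [lt|le'].
  by rewrite homog_eq0 // !mul0r pihomog0.
rewrite (pihomogM _ _ (homog_dhomog r s hA)) leq_subLR subnKC //.
case: leqP => _; last by rewrite mulr0.
by rewrite subnBA // subnK.
Qed.

(** Graded projectivity of [P]: the columns of [g] are lifted one by one with no control of degrees,
    and the degree-0 component of the result is still a lift by [homog_partM]. *)
Lemma homog_lift E F P (A : 'M[R]_(rk E, rk F)) (g : 'M[R]_(rk E, rk P)) :
  homog_map A -> homog_map g ->
  (forall v : 'cV[R]_(rk P), exists w : 'cV[R]_(rk F), g *m v = A *m w) ->
  exists2 h : 'M[R]_(rk F, rk P), homog_map h & A *m h = g.
Proof.
move=> hA hg ex.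
have /fin_all_exists[w hw] (c : 'I_(rk P)) : exists w, col c g = A *m w.
  by have [w] := ex (delta_mx c 0); rewrite -colE; exists w.
pose W := \matrix_(r, c) w c r 0.
have gE : g = A *m W.
  apply/matrixP => r c; have /matrixP/(_ r 0) := hw c; rewrite !mxE => ->.
  by apply: eq_bigr => s _; rewrite !mxE.
exists (homog_part W); first exact: homog_part_homog.
by rewrite -homog_partM // -gE homog_part_id.
Qed.

Lemma homog_usub E1 E2 F (A : 'M[R]_(rk E1 + rk E2, rk F)) :
  @homog_map k n (gsum E1 E2) F A -> homog_map (usubmx A : 'M_(rk E1, rk F)).
Proof.
move=> hA r c m; rewrite mxE => /hA /=.
by rewrite (unsplitK (inl r : _ + 'I_(rk E2))).
Qed.

Lemma homog_dsub E1 E2 F (A : 'M[R]_(rk E1 + rk E2, rk F)) :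
  @homog_map k n (gsum E1 E2) F A -> homog_map (dsubmx A : 'M_(rk E2, rk F)).
Proof.
move=> hA r c m; rewrite mxE => /hA /=.
by rewrite (unsplitK (inr r : 'I_(rk E1) + _)).
Qed.

Lemma homog_lsub E F1 F2 (A : 'M[R]_(rk E, rk F1 + rk F2)) :
  @homog_map k n E (gsum F1 F2) A -> homog_map (lsubmx A : 'M_(rk E, rk F1)).
Proof.
move=> hA r c m; rewrite mxE => /hA /=.
by rewrite (unsplitK (inl c : _ + 'I_(rk F2))).
Qed.

Lemma homog_rsub E F1 F2 (A : 'M[R]_(rk E, rk F1 + rk F2)) :
  @homog_map k n E (gsum F1 F2) A -> homog_map (rsubmx A : 'M_(rk E, rk F2)).
Proof.
move=> hA r c m; rewrite mxE => /hA /=.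
by rewrite (unsplitK (inr c : 'I_(rk F1) + _)).
Qed.

Lemma gdeg_enum_val e E (s : 'I_(rk (gpart e E))) :
  gdeg (enum_val s : 'I_(rk E)) = e.
Proof. by apply/eqP; exact: (enum_valP s). Qed.

Lemma homog_restr E F a b (A : 'M[R]_(rk E, rk F)) :
  homog_map A -> homog_map (restr a b A).
Proof.
move=> hA r c m; rewrite mxE => /hA.
by rewrite !gdeg_enum_val.
Qed.

Lemma restrN E F a b (A : 'M[R]_(rk E, rk F)) :
  restr a b (- A) = - restr a b A.
Proof. by apply/matrixP => r c; rewrite !mxE. Qed.

Lemma restrD E F a b (A B : 'M[R]_(rk E, rk F)) :
  restr a b (A + B) = restr a b A + restr a b B.
Proof. by apply/matrixP => r c; rewrite !mxE. Qed.

Lemma restr1 E a : restr a a (1%:M : 'M[R]_(rk E, rk E)) = 1%:M.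
Proof. by apply/matrixP => r c; rewrite !mxE (inj_eq enum_val_inj). Qed.

(** The full product sums over all generators of [F], the restricted one only over those of degree
    [b]. The hypothesis kills the difference; in applications it follows from degrees or from
    minimality. *)
Lemma restrM E F P a b d (A : 'M[R]_(rk E, rk F)) (B : 'M[R]_(rk F, rk P)) :
  (forall r s c, gdeg r = a -> gdeg c = d -> gdeg s != b ->
     A r s * B s c = 0) ->
  restr a d (A *m B) = restr a b A *m restr b d B.
Proof.
move=> h0; apply/matrixP => r c; rewrite !mxE.
rewrite (bigID [pred s : 'I_(rk F) | gdeg s == b]) /= addrC big1 ?add0r.
  rewrite (big_enum_val (A := [pred s : 'I_(rk F) | gdeg s == b])).
  by apply: eq_bigr => s _; rewrite !mxE.
by move=> s; apply: h0; rewrite gdeg_enum_val.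
Qed.

Lemma restrM0 E F P a d (A : 'M[R]_(rk E, rk F)) (B : 'M[R]_(rk F, rk P)) :
  (forall r s c, gdeg r = a -> gdeg c = d -> A r s * B s c = 0) ->
  restr a d (A *m B) = 0.
Proof.
move=> h0; apply/matrixP => r c; rewrite !mxE.
by apply: big1 => s _; apply: h0; rewrite gdeg_enum_val.
Qed.

End HomogeneousMaps.

(** * Comparison maps and homotopies, built by recursion on the homological degree *)

Lemma dependent_choice (X : nat -> Type) (good : forall i, X i -> Prop)
    (next : forall i, X i -> X i.+1 -> Prop) (x0 : X 0) :
  good 0 x0 ->
  (forall i x, good i x -> exists y, good i.+1 y /\ next i x y) ->
  exists f : forall i, X i,
    [/\ f 0 = x0, forall i, good i (f i) & forall i, next i (f i) (f i.+1)].
Proof.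
move=> good0 step.
(* The recursion carries each element together with its proof of [good], since a successor exists
   only under that invariant. *)
pose nx i (x : {x : X i | good i x}) :=
  constructive_indefinite_description _ (step i (sval x) (proj2_sig x)).
pose f : forall i, {x : X i | good i x} := nat_rect _ (exist _ x0 good0)
  (fun i x => exist _ (sval (nx i x)) (proj1 (proj2_sig (nx i x)))).
exists (fun i => sval (f i)); split=> // i; first exact: (proj2_sig (f i)).
exact: (proj2 (proj2_sig (nx i (f i)))).
Qed.

Section Comparison.
Context {k : fieldType} {n : nat}.
Local Notation R := {mpoly k[n]}.
Implicit Types (P X Y : rcomplex k n) (J : R -> Prop).

Lemma chain_map_id P : @chain_map k n P P (fun i => 1%:M).
Proof.
by split=> i; [exact: homog_map1 | rewrite mul1mx mulmx1].
Qed.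

Lemma chain_map_comp P X Y (f : forall i, 'M[R]_(rk (X i), rk (P i)))
    (g : forall i, 'M[R]_(rk (Y i), rk (X i))) :
  @chain_map k n P X f -> @chain_map k n X Y g ->
  @chain_map k n P Y (fun i => g i *m f i).
Proof.
move=> [hf cf] [hg cg]; split=> i; first exact: homog_mapM.
by rewrite mulmxA cg -mulmxA cf mulmxA.
Qed.

Lemma chain_mapB P X (f g : forall i, 'M[R]_(rk (X i), rk (P i))) :
  @chain_map k n P X f -> @chain_map k n P X g ->
  @chain_map k n P X (fun i => f i - g i).
Proof.
move=> [hf cf] [hg cg]; split=> i; first exact: homog_mapB.
by rewrite mulmxBl mulmxBr cf cg.
Qed.

(** Each map lifts the previous one composed with [gdiff P i]. The invariant [good] says that this
    lift exists: in degree 0 because both first differentials have image [J], afterwards by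
    exactness of [X]. *)
Lemma comparison_map J P X : resolution J P -> resolution J X ->
  exists2 f : forall i, 'M[R]_(rk (X i), rk (P i)),
    @chain_map k n P X f & f 0%N = 1%:M :> 'M[R]_1.
Proof.
move=> [[hP dP] exP JP] [[hX dX] exX JX].
pose good i (x : 'M[R]_(rk (X i), rk (P i))) := homog_map x /\
  forall v : 'cV_(rk (P i.+1)), exists w, x *m gdiff P i *m v = gdiff X i *m w.
pose next i (x : 'M[R]_(rk (X i), rk (P i))) y :=
  gdiff X i *m y = x *m gdiff P i.
have [||f [f0 fg fn]] := @dependent_choice _ good next (1%:M : 'M[R]_1).
- split=> [|v]; first exact: (@homog_map1 k n grR).
  have /JP/JX[w hw] : im_in_R (gdiff P 0) ((gdiff P 0 *m v) 0 0) by exists v.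
  exists w; rewrite mul1mx; apply/matrixP => i j.
  by rewrite (ord1 i) (ord1 j).
- move=> i x [hx lx].
  have [y hy yE] := homog_lift (hX i) (homog_mapM hx (hP i)) lx.
  exists y; split=> //; split=> // v; apply: exX.
  by rewrite mulmxA (mulmxA (gdiff X i)) yE -(mulmxA x) dP mulmx0 mul0mx.
by exists f => //; split=> i; [case: (fg i) | exact: fn].
Qed.

(** [h i.+1] lifts [g i.+1 - h i *m gdiff P i] along [gdiff X i.+1]. The invariant puts this
    difference in the kernel of [gdiff X i], so exactness applies; [g 0 = 0] allows the start
    [h 0 = 0]. *)
Lemma null_homotopic J P X (g : forall i, 'M[R]_(rk (X i), rk (P i))) :
  is_gcomplex P -> resolution J X -> @chain_map k n P X g -> g 0%N = 0 ->
  exists h : forall i, 'M[R]_(rk (X i.+1), rk (P i)),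
    [/\ forall i, homog_map (h i), h 0%N = 0
      & forall i, g i.+1 = gdiff X i.+1 *m h i.+1 + h i *m gdiff P i].
Proof.
move=> [hP dP] [[hX dX] exX _] [hg cg] g0.
pose good i (x : 'M[R]_(rk (X i.+1), rk (P i))) := homog_map x /\
  gdiff X i *m (g i.+1 - x *m gdiff P i) = 0.
pose next i (x : 'M[R]_(rk (X i.+1), rk (P i))) y :=
  gdiff X i.+1 *m y = g i.+1 - x *m gdiff P i.
have [||h [h0 hgood hn]] := @dependent_choice _ good next 0.
- split; first exact: homog_map0.
  by rewrite mul0mx subr0 cg g0 mul0mx.
- move=> i x [hx lx].
  have [||y hy yE] :=
    @homog_lift _ _ _ _ _ _ (g i.+1 - x *m gdiff P i) (hX i.+1).
  + by apply: homog_mapB => //; exact: homog_mapM.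
  + by move=> v; apply: exX; rewrite mulmxA lx mul0mx.
  exists y; split=> //; split=> //.
  by rewrite mulmxBr cg mulmxA yE mulmxBl -mulmxA dP mulmx0 subr0 subrr.
exists h; split=> // i; first by case: (hgood i).
by rewrite hn subrK.
Qed.

(** Serves both composites of the comparison maps. The value [h 0 = 0] is recorded because it
    settles homological degree 1 of the strand. *)
Lemma homotopic_id J P (g : forall i, 'M[R]_(rk (P i), rk (P i))) :
  resolution J P -> @chain_map k n P P g -> g 0%N = 1%:M ->
  exists h : forall i, 'M[R]_(rk (P i.+1), rk (P i)),
    [/\ forall i, homog_map (h i), h 0%N = 0
      & forall i, g i.+1 = 1%:M + (gdiff P i.+1 *m h i.+1 + h i *m gdiff P i)].
Proof.
move=> resP cg g0; have [cP _ _] := resP.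
have [|h [hh h0 hE]] := null_homotopic cP resP (chain_mapB cg (chain_map_id P)).
  by rewrite g0 subrr.
by exists h; split=> // i; rewrite -hE addrC subrK.
Qed.

End Comparison.

(** * Minimality and degrees of generators *)

Section MinimalResolutions.
Context {k : fieldType} {n : nat}.
Local Notation R := {mpoly k[n]}.

Lemma mcoeff0M (p q : R) : (p * q)@_0%MM = p@_0%MM * q@_0%MM.
Proof. exact: (mcoeff0_is_multiplicative n k).1. Qed.

Lemma mcoeff0_mulmx p q r (A : 'M[R]_(p, q)) (B : 'M[R]_(q, r)) i j :
  (forall s, (A i s)@_0%MM = 0) \/ (forall s, (B s j)@_0%MM = 0) ->
  ((A *m B) i j)@_0%MM = 0.
Proof.
move=> h; rewrite mxE raddf_sum big1 // => s _ /=.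
by rewrite mcoeff0M; case: h => ->; rewrite ?mul0r ?mulr0.
Qed.

(** Either [gdeg c <= gdeg s] and minimality kills [B s c], or [gdeg s < gdeg c <= gdeg r] and
    [A r s] would have negative degree. *)
Lemma homogM_min_eq0 (E F P : grfree) (A : 'M[R]_(rk E, rk F))
    (B : 'M[R]_(rk F, rk P)) r s c :
  homog_map A -> homog_map B -> (forall s c, (B s c)@_0%MM = 0) ->
  (gdeg c <= gdeg r)%N -> A r s * B s c = 0.
Proof.
move=> hA hB B0 le; case: (leqP (gdeg c) (gdeg s)) => [le'|lt].
  by rewrite (homog_min_eq0 hB) ?mulr0.
by rewrite (homog_eq0 hA) ?mul0r // (leq_trans lt).
Qed.

(** A zero column would put a basis vector in the kernel, hence in the image of the next
    differential, whose entries have no constant term. *)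
Lemma min_resolution_col_neq0 (J : R -> Prop) (F : rcomplex k n) i
    (c : 'I_(rk (F i.+1))) :
  min_resolution J F -> exists r, gdiff F i r c != 0.
Proof.
move=> [[_ exF _] minF]; apply/existsP; apply: contraT; rewrite negb_exists.
move=> /forallP col0.
have [|w /matrixP/(_ c 0)] := exF i (delta_mx c 0).
  apply/matrixP => r j; rewrite -colE !mxE; apply/eqP.
  by have := col0 r; rewrite negbK.
rewrite mxE !eqxx => /(congr1 (fun p : R => p@_0%MM)); rewrite mcoeff0_mulmx.
  by rewrite mcoeff1 eqxx => /eqP; rewrite oner_eq0.
by left=> s; exact: minF.
Qed.

(** Each generator has a nonzero entry in its column. For [i = 0] that entry is a form in [J] of
    degree [gdeg c]; later it has positive degree by minimality, so degrees grow by at least one per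
    step. *)
Lemma min_resolution_gdeg (J : R -> Prop) (F : rcomplex k n) l :
  min_resolution J F ->
  (forall f d, J f -> f != 0 -> f \is d.-homog -> (l <= d)%N) ->
  forall i (c : 'I_(rk (F i.+1))), (l + i <= gdeg c)%N.
Proof.
move=> hF lJ; have [[[homF _] _ JF] minF] := hF.
elim=> [|i IH] c; have [r nz] := min_resolution_col_neq0 c hF.
  rewrite addn0; apply: (lJ (gdiff F 0 r c)) nz _.
    apply/JF; exists (delta_mx c 0).
    by rewrite -colE mxE; congr (gdiff F 0 _ _); apply: val_inj; case: r => -[].
  by have := homog_dhomog r c (homF 0%N); rewrite subn0.
rewrite addnS (leq_ltn_trans (IH r)) // ltnNge.
by apply: contraNN nz => le; apply/eqP/homog_min_eq0/le/minF/homF.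
Qed.

Lemma min_resolution_proper (J : R -> Prop) (F : rcomplex k n) f :
  min_resolution J F -> J f -> f@_0%MM = 0.
Proof.
move=> [[_ _ JF] minF] /JF[v ->]; apply: mcoeff0_mulmx.
by left=> s; exact: (minF 0%N).
Qed.

(** Supplies the bound 1 on the initial degree of each [a j], as needed for the degrees of the
    generators of [G j]. *)
Lemma proper_homog_gt0 (J : R -> Prop) (F : rcomplex k n) f d :
  min_resolution J F -> J f -> f != 0 -> f \is d.-homog -> (0 < d)%N.
Proof.
move=> hF Jf nz hf; rewrite lt0n; apply: contraNneq nz => d0.
apply/eqP/mpolyP => m; rewrite mcoeff0.
have [->|m0] := eqVneq m 0%MM; first exact: (min_resolution_proper hF).
by apply: (dhomog_nemf_coeff hf); rewrite d0 mdeg_eq0.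
Qed.

End MinimalResolutions.

(** * Consequences of the splitting of [F_1] *)

Section Splitting.
Context {k : fieldType} {n : nat} {F : rcomplex k n} {F1' : grfree} {t : nat}.
Local Notation R := {mpoly k[n]}.
Context {iota : 'M[R]_(rk (F 1%N), rk F1')}.
Context {e : 'I_t -> 'cV[R]_(rk (F 1%N))} {dege : 'I_t -> nat}.
Context (hsplit : splitting iota e dege).

Lemma splitting_inj (u v : 'cV[R]_(rk F1')) (c d : 'cV[R]_t) :
  iota *m u + \sum_j c j 0 *: e j = iota *m v + \sum_j d j 0 *: e j ->
  u = v /\ c = d.
Proof.
case: hsplit => _ _ /bij_inj inj uv.
by have [] := inj (u, c) (v, d) uv.
Qed.

(** [iota] would kill a basis element of degree below [l] for degree reasons, against
    injectivity. *)
Lemma splitting_degF1' l :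
  (forall s : 'I_(rk (F 1%N)), (l <= gdeg s)%N) ->
  forall c : 'I_(rk F1'), (l <= gdeg c)%N.
Proof.
have [hiota _ _] := hsplit => lF c; rewrite leqNgt; apply/negP => lt.
have i0 : iota *m (delta_mx c 0 : 'cV_(rk F1')) = 0.
  rewrite -colE; apply/matrixP => r j; rewrite !mxE.
  by rewrite (homog_eq0 hiota) // (leq_trans lt).
have [|/matrixP/(_ c 0)] := @splitting_inj (delta_mx c 0) 0 0 0.
  by rewrite i0 mulmx0.
by rewrite !mxE !eqxx => /eqP; rewrite oner_eq0.
Qed.

Lemma splitting_dege l :
  (forall s : 'I_(rk (F 1%N)), (l <= gdeg s)%N) -> forall j, (l <= dege j)%N.
Proof.
have [_ he _] := hsplit => lF j; rewrite leqNgt; apply/negP => lt.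
have e0 : e j = 0.
  apply/matrixP => r i; rewrite (homog_eq0 (he j)) ?mxE //=.
  exact: leq_trans (lF r).
have [|_ /matrixP/(_ j 0)] := @splitting_inj 0 0 (delta_mx j 0) 0.
  congr (_ + _); rewrite !big1 // => i _; first by rewrite mxE scale0r.
  by rewrite mxE; case: eqVneq => [->|_]; rewrite ?e0 ?scaler0 // scale0r.
by rewrite !mxE !eqxx => /eqP; rewrite oner_eq0.
Qed.

(** The projection of [F_1] onto [F1'] is a matrix [U], and each column of [d2'] is [U] applied to a
    column of [gdiff F 1], whose entries have no constant term. *)
Lemma splitting_minimal (d2' : 'M[R]_(rk F1', rk (F 2%N)))
    (d0 : 'I_t -> 'M[R]_(rk (F 1%N), rk (F 2%N))) (a : 'I_t -> R -> Prop) :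
  gdiff F 1 = iota *m d2' + \sum_(j < t) d0 j ->
  (forall j (v : 'cV[R]_(rk (F 2%N))),
     exists2 x, a j x & d0 j *m v = x *: e j) ->
  minimal F -> forall r c, (d2' r c)@_0%MM = 0.
Proof.
move=> hd2 hd0 minF r c; have [_ _ bij] := hsplit.
pose E : 'M_(rk (F 1%N), t) := \matrix_(i, j) e j i 0.
have EE (w : 'cV_t) : \sum_j w j 0 *: e j = E *m w.
  apply/matrixP => i j; rewrite (ord1 j) summxE mxE; apply: eq_bigr => s _.
  by rewrite !mxE mulrC.
(* The inverse supplied by [bijective] is only a function, so the matrices [U] and [V] are assembled
   from its values on basis vectors. *)
have /fin_all_exists[w hw] (s : 'I_(rk (F 1%N))) :
    exists w : 'cV_(rk F1') * 'cV_t, delta_mx s 0 = iota *m w.1 + E *m w.2.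
  have [g _ gK] := bij; exists (g (delta_mx s 0)).
  by rewrite -EE; exact/esym/gK.
pose U := \matrix_(i, s) (w s).1 i 0; pose V := \matrix_(i, s) (w s).2 i 0.
have UV : 1%:M = iota *m U + E *m V.
  apply/matrixP => i s; have /matrixP/(_ i 0) := hw s.
  rewrite !mxE eqxx andbT => ->.
  by congr (_ + _); apply: eq_bigr => q _; rewrite !mxE.
have /fin_all_exists[x hx] j : exists x, d0 j *m delta_mx c 0 = x *: e j.
  by have [x _ hx] := hd0 j (delta_mx c 0); exists x.
have [D DE] : exists D : 'cV_(rk (F 1%N)), D = gdiff F 1 *m delta_mx c 0.
  by exists (gdiff F 1 *m delta_mx c 0).
have D1 : D = iota *m (d2' *m delta_mx c 0) + E *m (\col_j x j).
  rewrite DE hd2 mulmxDl mulmxA mulmx_suml -EE; congr (_ + _).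
  by apply: eq_bigr => j _; rewrite hx mxE.
have D2 : D = iota *m (U *m D) + E *m (V *m D).
  by rewrite !mulmxA -mulmxDl -UV mul1mx.
(* [D] has been expanded in two ways, through [d2'] and through [U]; coordinates in the splitting
   are unique. *)
have [/matrixP/(_ r 0) rE _] :
    d2' *m delta_mx c 0 = U *m D /\ \col_j x j = V *m D.
  by apply: splitting_inj; rewrite !EE -D1 -D2.
move: rE; rewrite -colE mxE => ->; apply: mcoeff0_mulmx; right=> s.
by rewrite DE -colE mxE; exact: minF.
Qed.

(** Gives [J] inside [I], so that [l] bounds the degrees of the forms in [J] and hence of the
    generators of [H]. *)
Lemma trimmed_ideal_sub (I : R -> Prop) (a : 'I_t -> R -> Prop) f :
  is_ideal I -> (forall g, im_in_R (gdiff F 0) g -> I g) ->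
  trimmed_ideal iota e a f -> I f.
Proof.
move=> [I0 ID IM] imI [p [q [[v pE] [x [hx qE]] ->]]]; rewrite pE qE.
apply: (ID); first by apply: imI; exists (iota *m v); rewrite mulmxA.
apply: (big_ind I I0 ID) => j _; have [m [b [c [bc ->]]]] := hx j.
apply: (big_ind I I0 ID) => i _; apply: IM; apply: imI.
by have [_ [w wE]] := bc i; rewrite wE; exists (e j *m w); rewrite mulmxA.
Qed.

End Splitting.

(** * Restricting products to a single degree *)

Lemma restr_minl (k : fieldType) (n : nat) (E F P : grfree)
    (A : 'M[{mpoly k[n]}]_(rk E, rk F)) (B : 'M[{mpoly k[n]}]_(rk F, rk P)) a :
  homog_map A -> homog_map B -> (forall s c, (B s c)@_0%MM = 0) ->
  restr a a (A *m B) = 0.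
Proof.
move=> hA hB B0; apply: restrM0 => r s c ra ca.
by apply: homogM_min_eq0 => //; rewrite ra ca.
Qed.

(** [B] sends generators of degree [d] only to generators of degree at most [d], and [F] has none
    below [d]. *)
Lemma restrM_ge (k : fieldType) (n : nat) (E F P : grfree)
    (A : 'M[{mpoly k[n]}]_(rk E, rk F)) (B : 'M[{mpoly k[n]}]_(rk F, rk P))
    a d :
  homog_map B -> (forall s : 'I_(rk F), (d <= gdeg s)%N) ->
  restr a d (A *m B) = restr a d A *m restr d d B.
Proof.
move=> hB ge; apply: restrM => r s c _ cd sd.
by rewrite (homog_eq0 hB) ?mulr0 // cd ltn_neqAle eq_sym sd ge.
Qed.

Lemma restrM_gt (k : fieldType) (n : nat) (E F P : grfree)
    (A : 'M[{mpoly k[n]}]_(rk E, rk F)) (B : 'M[{mpoly k[n]}]_(rk F, rk P))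
    a d :
  homog_map B -> (forall s : 'I_(rk F), (d < gdeg s)%N) ->
  restr a d (A *m B) = 0.
Proof.
move=> hB gt; apply: restrM0 => r s c _ cd.
by rewrite (homog_eq0 hB) ?mulr0 // cd.
Qed.

Lemma ulsubmxD (V : nmodType) m1 m2 n1 n2 (A B : 'M[V]_(m1 + m2, n1 + n2)) :
  ulsubmx (A + B) = ulsubmx A + ulsubmx B.
Proof. by apply/matrixP => i j; rewrite !mxE. Qed.

(** * Comparison of the minimal resolution [H] with the trimming complex *)

Theorem corollary3p5 (k : fieldType) (n : nat)
    (I : {mpoly k[n]} -> Prop) (l : nat) (F : rcomplex k n)
    (hI : homog_ideal I) (hl : initial_degree I l) (hF : min_resolution I F)
    (t : nat) (F1' : grfree)
    (iota : 'M[{mpoly k[n]}]_(rk (F 1%N), rk F1'))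
    (e : 'I_t -> 'cV[{mpoly k[n]}]_(rk (F 1%N))) (dege : 'I_t -> nat)
    (hsplit : splitting iota e dege)
    (d2' : 'M[{mpoly k[n]}]_(rk F1', rk (F 2%N)))
    (d0 : 'I_t -> 'M[{mpoly k[n]}]_(rk (F 1%N), rk (F 2%N)))
    (hd2 : gdiff F 1 = iota *m d2' + \sum_(j < t) d0 j)
    (a : 'I_t -> {mpoly k[n]} -> Prop) (ha : forall j, homog_ideal (a j))
    (hd0 : forall j (v : 'cV[{mpoly k[n]}]_(rk (F 2%N))),
       exists2 x, a j x & d0 j *m v = x *: e j)
    (G : 'I_t -> rcomplex k n) (hG : forall j, min_resolution (a j) (G j))
    (Q : forall i, 'M[{mpoly k[n]}]_(rk (bot_tail G dege i), rk (F i.+2)))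
    (hQ : iterated_trimming (trimmed_ideal iota e a) iota d2' e Q)
    (H : rcomplex k n) (hH : min_resolution (trimmed_ideal iota e a) H) :
  iso_subcomplex (linear_strand l H)
    (@trimmed_strand k n F F1' t l d2' G dege Q).
Proof.
have [[[hFd _] _ FI] minF] := hF.
have [hv resT] := hQ; have [[[hTd _] _ _] [hvh hvc]] := (resT, hv).
have [resH minH] := hH; have [[hHd _] _ _] := resH.
have subJ f : trimmed_ideal iota e a f -> I f.
  by apply: trimmed_ideal_sub => [|g /FI //]; case: hI.
have lI f d : I f -> f != 0 -> f \is d.-homog -> (l <= d)%N.
  by case: hl => _ /(_ f d).
have degF := min_resolution_gdeg hF lI.
have degH := min_resolution_gdeg hH (fun f d Jf => lI f d (subJ f Jf)).
have degG j := min_resolution_gdeg (hG j)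
  (fun f d => @proper_homog_gt0 _ _ _ _ f d (hG j)).
have degF1 s : (l <= gdeg (s : 'I_(rk (F 1%N))))%N by rewrite -[l]addn0 degF.
have deg_top i (s : 'I_(rk (@top_mod _ _ F F1' i))) : (l + i <= gdeg s)%N.
  case: i s => [|i] s; last exact: degF.
  by rewrite addn0; exact: (splitting_degF1' hsplit degF1).
(* The shift contributes at least [l] and [G j i.+1] at least [i + 1], hence the strict
   inequality. *)
have deg_bot i (s : 'I_(rk (bot_tail G dege i))) : (l + i < gdeg s)%N.
  rewrite /= addnC -addSn leq_add ?(splitting_dege hsplit) //.
  exact: degG.
have min_top i r c : (top_diff d2' i r c)@_0%MM = 0.
  case: i r c => [|i] r c; last exact: minF.
  exact: (splitting_minimal hsplit hd2 hd0 minF).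
set T := cone _ in resT hTd.
have [al [hal cal] al0] := comparison_map resH resT.
have [be [hbe cbe] be0] := comparison_map resT resH.
have [|h [hh h0 hE]] :=
  homotopic_id resH (chain_map_comp (conj hal cal) (conj hbe cbe)).
  by rewrite al0 be0 mulmx1.
have [|h' [hh' h'0 hE']] :=
  homotopic_id resT (chain_map_comp (conj hbe cbe) (conj hal cal)).
  by rewrite al0 be0 mulmx1.
(* [T i.+1] is the sum of [top i] and [bot i]; [al], [be] and the homotopy [h'] are now split into
   blocks accordingly. *)
pose top := @top_mod k n F F1'; pose bot := bot_tail G dege.
pose At i : 'M_(rk (top i), rk (H i.+1)) := usubmx (al i.+1).
pose Ab i : 'M_(rk (bot i), rk (H i.+1)) := dsubmx (al i.+1).
pose Bt i : 'M_(rk (H i.+1), rk (top i)) := lsubmx (be i.+1).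
pose Bb i : 'M_(rk (H i.+1), rk (bot i)) := rsubmx (be i.+1).
have alE i : al i.+1 = col_mx (At i) (Ab i) by rewrite vsubmxK.
have beE i : be i.+1 = row_mx (Bt i) (Bb i) by rewrite hsubmxK.
have hAt i : homog_map (At i).
  exact: (@homog_usub _ _ (top i) (bot i) (H i.+1) _ (hal i.+1)).
have hAb i : homog_map (Ab i).
  exact: (@homog_dsub _ _ (top i) (bot i) (H i.+1) _ (hal i.+1)).
have hBt i : homog_map (Bt i).
  exact: (@homog_lsub _ _ (H i.+1) (top i) (bot i) _ (hbe i.+1)).
have hBb i : homog_map (Bb i).
  exact: (@homog_rsub _ _ (H i.+1) (top i) (bot i) _ (hbe i.+1)).
have caltop i : - top_diff d2' i *m At i.+1 = At i *m gdiff H i.+1.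
  have := cal i.+1; rewrite !alE [gdiff T _]/= mul_block_col mul_col_mx.
  by rewrite mul0mx addr0 => /eq_col_mx[].
have calbot i :
    Q i *m At i.+1 + bot_diff G dege e i.+1 *m Ab i.+1 = Ab i *m gdiff H i.+1.
  have := cal i.+1; rewrite !alE [gdiff T _]/= mul_block_col mul_col_mx.
  by rewrite mul0mx addr0 => /eq_col_mx[].
have hEt i : Bt i *m At i + Bb i *m Ab i =
    1%:M + (gdiff H i.+1 *m h i.+1 + h i *m gdiff H i).
  by rewrite -hE alE beE mul_row_col.
pose U i : 'M_(rk (top i.+1), rk (top i)) :=
  ulsubmx (h' i.+1).
pose V i : 'M_(rk (top i.+1), rk (bot i)) :=
  ursubmx (h' i.+1).
have hU i : homog_map (U i).
  apply: (@homog_lsub _ _ (top i.+1) (top i) (bot i)).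
  exact: (@homog_usub _ _ (top i.+1) (bot i.+1) (T i.+1) _
           (hh' i.+1)).
have htop i : homog_map (top_diff d2' i).
  have := @homog_lsub _ _ (top i) (top i.+1) (bot i.+1) _
    (@homog_usub _ _ (top i) (bot i) (T i.+2) _ (hTd i.+1)).
  rewrite /= col_mxKu row_mxKl => hT.
  by rewrite -[top_diff _ _]opprK; apply: homog_mapN.
have dh' i : gdiff T i.+1 *m h' i.+1 =
    block_mx (- top_diff d2' i *m U i) (- top_diff d2' i *m V i)
      (Q i *m U i + bot_diff G dege e i.+1 *m dlsubmx (h' i.+1))
      (Q i *m V i + bot_diff G dege e i.+1 *m drsubmx (h' i.+1)).
  rewrite -[h' i.+1 in LHS]submxK [gdiff T _]/= mulmx_block.
  by rewrite !mul0mx !addr0.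
have h'd i : h' i.+1 *m gdiff T i.+1 =
    block_mx (U i *m - top_diff d2' i + V i *m Q i)
      (V i *m bot_diff G dege e i.+1)
      (dlsubmx (h' i.+1) *m - top_diff d2' i + drsubmx (h' i.+1) *m Q i)
      (drsubmx (h' i.+1) *m bot_diff G dege e i.+1).
  rewrite -[h' i.+1 in LHS]submxK [gdiff T _]/= mulmx_block.
  by rewrite !mulmx0 !add0r.
(* The summand [h' i *m gdiff T i] is left unexpanded: for [i = 0] it is zero, while for a successor
   [h'd] gives its blocks. *)
have hEb i : At i *m Bt i =
    1%:M + (- top_diff d2' i *m U i + ulsubmx (h' i *m gdiff T i)).
  have := hE' i; rewrite alE beE mul_col_row dh' => /(congr1 ulsubmx).
  by rewrite /= block_mxKul !ulsubmxD block_mxKul scalar_mx_block block_mxKul.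
have rBA i :
    restr (l + i) (l + i) (Bt i) *m restr (l + i) (l + i) (At i) = 1%:M.
  (* Three error terms vanish in degree [l + i]: [Bb *m Ab] and [gdiff H *m h] pass through
     generators of larger degree, and [h *m gdiff H] dies by minimality of [H]. *)
  rewrite -restrM_ge // -[Bt i *m At i](addrK (Bb i *m Ab i)) hEt.
  rewrite !restrD restrN restr1 (restrM_gt _ _ (hAb i) (deg_bot i)) oppr0 addr0.
  rewrite (restrM_gt _ _ (hh i.+1)) => [|s]; last by rewrite -addnS degH.
  by rewrite (restr_minl _ (hh i) (hHd i) (minH i)) !addr0.
have rAB i : restr (l + i) (l + i) (At i) *m restr (l + i) (l + i) (Bt i) =
    1%:M + restr (l + i) (l + i) (ulsubmx (h' i *m gdiff T i)).
  rewrite -restrM_ge // hEb !restrD restr1.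
  by rewrite (restrM_gt _ _ (hU i)) ?add0r // => s; rewrite -addnS deg_top.
have rQA i : restr (l + i.+1) (l + i.+1) (Q i)
    *m restr (l + i.+1) (l + i.+1) (At i.+1) = 0.
  rewrite -(restrM_ge _ _ (hAt i.+1)) //.
  (* By [calbot] the product is [Ab *m gdiff H] minus a term through [bot i.+1]; the first dies by
     minimality, the second by degree. *)
  rewrite -[Q i *m _](addrK (bot_diff G dege e i.+1 *m Ab i.+1)) calbot.
  rewrite restrD restrN (restr_minl _ (hAb i) (hHd _) (minH _)).
  by rewrite (restrM_gt _ _ (hAb _) (deg_bot _)) subrr.
have rcal i : restr (l + i) (l + i.+1) (top_diff d2' i)
      *m restr (l + i.+1) (l + i.+1) (At i.+1) =
    - (restr (l + i) (l + i) (At i) *m restr (l + i) (l + i.+1) (gdiff H i.+1)).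
  rewrite -(restrM_ge _ _ (hAt i.+1)) //.
  rewrite -[top_diff _ _ *m _]opprK -mulNmx caltop restrN.
  (* A generator of [H i.+1] outside degree [l + i] has degree at least [l + i.+1], that of [c], so
     a minimal entry there is zero. *)
  rewrite -restrM // => r s c ra ca sa.
  rewrite (homog_min_eq0 (hHd _) (minH _ _ _)) ?mulr0 // ca addnS.
  by rewrite ltn_neqAle eq_sym sa degH.
exists (fun i => (-1) ^+ i *: restr (l + i) (l + i) (At i)); split.
- split=> i.
    have hR := homog_restr (a := (l + i)%N) (b := (l + i)%N) (hAt i).
    rewrite -signr_odd; case: (odd i); rewrite ?scaleN1r ?scale1r //.
    exact: (homog_mapN hR).
  by rewrite /= -scalemxAr rcal exprS mulN1r scaleNr scalerN opprK -scalemxAl.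
- move=> i u; rewrite -scalemxAl => /(congr1 (fun x => (-1) ^+ i *: x)).
  rewrite scalerA -expr2 sqrr_sign scale1r scaler0.
  move=> /(congr1 (mulmx (restr (l + i) (l + i) (Bt i)))).
  by rewrite mulmxA rBA mul1mx mulmx0.
move=> i v; split=> [Cv|[u ->]].
  (* The preimage comes from [Bt]; by [rAB] it remains to see that the homotopy term kills [v]. *)
  exists ((-1) ^+ i *: (restr (l + i) (l + i) (Bt i) *m v)).
  rewrite -scalemxAl -scalemxAr scalerA -expr2 sqrr_sign scale1r.
  rewrite mulmxA rAB; case: i v Cv => [|i] v Cv.
    have -> : restr (l + 0) (l + 0) (ulsubmx (h' 0%N *m gdiff T 0)) = 0.
      by rewrite h'0 mul0mx; apply/matrixP => r c; rewrite !mxE.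
    by rewrite addr0 mul1mx.
  have hQi : homog_map (Q i) by exact: (hvh i.+1).
  (* The term through [top_diff] dies by minimality. Generators of [bot i] may have degree exactly
     [l + i.+1], so [V i *m Q i] can survive, but it factors through the restricted [Q i], which
     kills [v]. *)
  rewrite h'd block_mxKul restrD (restr_minl _ (hU i)).
  + rewrite add0r (restrM_ge _ _ hQi) => [|s]; last by rewrite addnS deg_bot.
    by rewrite mulmxDl mul1mx -mulmxA Cv mulmx0 addr0.
  + exact/homog_mapN/htop.
  + by move=> s c; rewrite mxE mcoeffN min_top oppr0.
case: i v u => [|i] v u //=.
by rewrite -scalemxAl -scalemxAr mulmxA rQA mul0mx scaler0.
Qed.
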